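(* Let $\lambda$ be a nonzero cardinal, $S$ a monoid and $\theta\colon S\to H_S(1_S)$ a homomorphism. The semigroup $\mathscr{P}_\lambda(\theta,S)$ is $0$-bisimple if and only if the semigroup $S$ is bisimple.
   Context: A semigroup is bisimple if it has a single $\mathscr{D}$-class (Green's relation $\mathscr{D}=\mathscr{L}\circ\mathscr{R}$); a semigroup $T$ is $0$-bisimple if it has a zero and has exactly two $\mathscr{D}$-classes, $\{0\}$ and $T\setminus\{0\}$. For a nonzero cardinal $\lambda$, $\lambda^*$ is the free monoid over the alphabet $\lambda$, $\varepsilon$ is the empty word and $|a|$ is the length of a word $a$. The $\lambda$-polycyclic monoid $P_\lambda$ is the semigroup with zero $0$ and identity $1$ generated by $\{p_i\}_{i\in\lambda}\cup\{p_i^{-1}\}_{i\in\lambda}$ subject to $p_ip_i^{-1}=1$ and $p_ip_j^{-1}=0$ for $i\ne j$ (for $\lambda=1$ it is the bicyclic monoid with adjoined zero). Identifying words of $\lambda^*$ with products of the $p_i$, each nonzero element of $P_\lambda$ is uniquely of the form $a^{-1}b$ with $a,b\in\lambda^*$. For a monoid $S$ with identity $1_S$, $H_S(1_S)$ is its group of units. Given a homomorphism $\theta\colon S\to H_S(1_S)$, put $\theta^0(s)=s$ and $\theta^n=\theta\circ\cdots\circ\theta$ ($n$ times). The Bruck–Reilly $\lambda$-polycyclic extension is the set $\mathscr{P}_\lambda(\theta,S)=(S\times(P_\lambda\setminus\{0\}))\sqcup\{\boldsymbol{0}\}$ with the associative operation $*$ for which $\boldsymbol{0}$ is a zero and $$(s,a_1^{-1}a_2)*(t,b_1^{-1}b_2)=\begin{cases}(\theta^{|u|}(s)t,(ua_1)^{-1}b_2),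 & \text{if } b_1=ua_2 \text{ for some } u\in\lambda^*,\\ (s\theta^{|v|}(t),a_1^{-1}vb_2), & \text{if } a_2=vb_1 \text{ for some } v\in\lambda^*,\\ \boldsymbol{0}, & \text{otherwise.}\end{cases}$$ *)

(* Defs.v *)
From HB Require Import structures.
From mathcomp Require Import all_boot.
From mathcomp Require Import classical_sets.

Set Implicit Arguments.
Unset Strict Implicit.
Unset Printing Implicit Defensive.

Local Open Scope classical_set_scope.
Local Open Scope group_scope.

Section Green.
Variable T : semigroupType.
Implicit Types x y z : T.

(* The principal one-sided ideals T^1 x and x T^1. *)
Definition lideal x : set T := x |` range (fun t : T => t * x).
Definition rideal x : set T := x |` range (fun t : T => x * t).

Definition greenL x y := lideal x = lideal y.
Definition greenR x y := rideal x = rideal y.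
Definition greenD x y := exists2 z, greenL x z & greenR z y.

Definition D_classes : set (set T) := range (fun x => [set y | greenD x y]).

Definition bisimple := exists C, D_classes = [set C].

Definition is_zero z := forall x, z * x = z /\ x * z = z.

(* The two sets on the right are automatically distinct, and the complement
   of z is then nonempty, D-classes being nonempty. *)
Definition zero_bisimple :=
  exists2 z, is_zero z & D_classes = [set [set z]; ~` [set z]].

End Green.

Definition group_of_units (S : monoidType) : set S :=
  [set x | exists y, x * y = 1 /\ y * x = 1].
Arguments group_of_units S : clear implicits.

(* [Some (a, b)] is the nonzero element a^-1 b of the polycyclic monoid, and
   [None] is 0.  Concatenation of words is the product of the p_i, so that
   (u a)^-1 = a^-1 u^-1 is encoded by the word [u ++ a].  The lemmas
   [polycyclic_rel], [polycyclic_rel0] and [polycyclic_universal] below say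
   that this is indeed the monoid with zero given by the usual presentation. *)
Definition polycyclic_nz (lambda : choiceType) := (seq lambda * seq lambda)%type.
Definition polycyclic (lambda : choiceType) := option (polycyclic_nz lambda).
HB.instance Definition _ lambda := Choice.on (polycyclic lambda).

(* If b = u ++ a, then [strip a b] is u. *)
Definition strip (T : Type) (a b : seq T) := take (size b - size a) b.

Definition polycyclic_mul (lambda : choiceType) (x y : polycyclic lambda) :
    polycyclic lambda :=
  if x is Some (a1, a2) then if y is Some (b1, b2) then
    if suffix a2 b1 then Some (strip a2 b1 ++ a1, b2)
    else if suffix b1 a2 then Some (a1, strip b1 a2 ++ b2)
    else None
  else None else None.

(* [Some (s, (a, b))] is the pair (s, a^-1 b) and [None] is the zero.  The maps
   of interest satisfy [range theta `<=` group_of_units S]; associativity of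
   the product only needs [theta] to be multiplicative.  A semigroup morphism
   into a group preserves 1, so this is not required separately. *)
Definition bruck_reilly (lambda : choiceType) (S : monoidType)
    (theta : {multiplicative S -> S}) :=
  option (S * polycyclic_nz lambda).
HB.instance Definition _ lambda S theta :=
  Choice.on (@bruck_reilly lambda S theta).

(* The three cases are [bruck_reilly_mulL], [bruck_reilly_mulR] and
   [bruck_reilly_mul0] below; the first two agree when both apply. *)
Definition bruck_reilly_mul (lambda : choiceType) (S : monoidType)
    (theta : {multiplicative S -> S}) (x y : bruck_reilly lambda theta) :
    bruck_reilly lambda theta :=
  if x is Some (s, (a1, a2)) then if y is Some (t, (b1, b2)) then
    if suffix a2 b1 then
      let u := strip a2 b1 in
      Some (iter (size u) theta s * t, (u ++ a1, b2))
    else if suffix b1 a2 then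
      let v := strip b1 a2 in
      Some (s * iter (size v) theta t, (a1, v ++ b2))
    else None
  else None else None.

Lemma strip_cat (T : Type) (u a : seq T) : strip a (u ++ a) = u.
Proof. by rewrite /strip size_cat addnK take_size_cat. Qed.

Lemma suffix_catr_id (T : eqType) (u v a : seq T) :
  suffix (u ++ a) (v ++ a) = suffix u v.
Proof. by rewrite suffix_catl // eqxx. Qed.

Lemma suffix_cat_nil (T : eqType) (v b : seq T) :
  suffix (v ++ b) b -> v = [::].
Proof.
move=> /size_suffix; rewrite size_cat -[leqRHS]add0n leq_add2r leqn0.
exact: nilP.
Qed.

Variant overlap_spec (T : eqType) (a b : seq T) : Prop :=
| OverlapL u of b = u ++ a
| OverlapR v of a = v ++ b
| OverlapN of suffix a b = false & suffix b a = false.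

Lemma overlapP (T : eqType) (a b : seq T) : overlap_spec a b.
Proof.
case: (boolP (suffix a b)) => [/suffixP[u]|/negbTE ab]; first exact: OverlapL.
case: (boolP (suffix b a)) => [/suffixP[v]|/negbTE]; first exact: OverlapR.
exact: OverlapN.
Qed.

Lemma noverlap_cat (T : eqType) (a b v : seq T) :
  suffix a b = false -> suffix b a = false ->
  suffix a (v ++ b) = false /\ suffix (v ++ b) a = false.
Proof.
move=> ab ba; split; apply/negP; last by move=> /catl_suffix; rewrite ba.
move=> h; have := suffix_suffix v b.
move: h => /suffixP[u1 e1] /suffixP[u2 e2].
have [le|/ltnW le] := leqP (size a) (size b).
  suff: suffix a b by rewrite ab.
  have -> : b = drop (size (v ++ b) - size b) (v ++ b).
    by rewrite size_cat addnK drop_size_cat.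
  rewrite e1; apply/suffixP; exists (drop (size (u1 ++ a) - size b) u1).
  rewrite drop_cat; case: ltnP => // h.
  have h1 : size (u1 ++ a) - size b <= size u1.
    by rewrite size_cat leq_subLR addnC leq_add2r.
  have h2: size (u1 ++ a) - size b = size u1 by apply/eqP; rewrite eqn_leq h1.
  by rewrite h2 subnn drop0 drop_size.
suff: suffix b a by rewrite ba.
have -> : a = drop (size (u1 ++ a) - size a) (u1 ++ a).
  by rewrite size_cat addnK drop_size_cat.
rewrite -e1; apply/suffixP; exists (drop (size (v ++ b) - size a) v).
rewrite drop_cat; case: ltnP => // h.
have h1 : size (v ++ b) - size a <= size v.
  by rewrite size_cat leq_subLR addnC leq_add2r.
have h2: size (v ++ b) - size a = size v by apply/eqP; rewrite eqn_leq h1.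
by rewrite h2 subnn drop0 drop_size.
Qed.

Section BruckReilly.
Variables (lambda : choiceType) (S : monoidType).
Variable theta : {multiplicative S -> S}.
Implicit Types (s t : S) (a b u v : seq lambda).
Local Notation mul := (@bruck_reilly_mul lambda S theta).

Lemma iter_thetaM n s t :
  iter n theta (s * t) = iter n theta s * iter n theta t.
Proof. by elim: n => //= n ->; rewrite gmulfM. Qed.

Lemma bruck_reilly_mulL s t a1 a2 u b2 :
  mul (Some (s, (a1, a2))) (Some (t, (u ++ a2, b2))) =
  Some (iter (size u) theta s * t, (u ++ a1, b2)).
Proof. by rewrite /bruck_reilly_mul suffix_suffix strip_cat. Qed.

Lemma bruck_reilly_mulR s t a1 v b1 b2 :
  mul (Some (s, (a1, v ++ b1))) (Some (t, (b1, b2))) =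
  Some (s * iter (size v) theta t, (a1, v ++ b2)).
Proof.
rewrite /bruck_reilly_mul suffix_suffix strip_cat.
by case: ifP => // /suffix_cat_nil ->; rewrite /strip subnn take0.
Qed.

Lemma bruck_reilly_mul0 s t a1 a2 b1 b2 :
  ~ (exists u, b1 = u ++ a2) -> ~ (exists v, a2 = v ++ b1) ->
  mul (Some (s, (a1, a2))) (Some (t, (b1, b2))) = None.
Proof.
move=> h1 h2; rewrite /bruck_reilly_mul.
by case: suffixP => // _; case: suffixP.
Qed.

Lemma bruck_reilly_mulF s t a1 a2 b1 b2 :
  suffix a2 b1 = false -> suffix b1 a2 = false ->
  mul (Some (s, (a1, a2))) (Some (t, (b1, b2))) = None.
Proof. by rewrite /bruck_reilly_mul => -> ->. Qed.

Lemma bruck_reilly_mulx0 x : mul x None = None.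
Proof. by case: x => [[s []]|]. Qed.

Lemma bruck_reilly_mulA : associative mul.
Proof.
have E := (bruck_reilly_mulL, bruck_reilly_mulR, iter_thetaM).
move=> [[s [a1 a2]]|//] [[t [b1 b2]]|//].
move=> [[r [c1 c2]]|]; last by rewrite !bruck_reilly_mulx0.
have [w|w|bc cb] := overlapP b2 c1; have [u|v|ab ba] := overlapP a2 b1.
- by move=> -> ->; rewrite !E !catA !E size_cat iterD mulgA.
- move=> -> ->; rewrite !E.
  have [k ->|k ->|vw wv] := overlapP v w.
  + by rewrite -!catA !E size_cat iterD !mulgA.
  + by rewrite -!catA !E size_cat iterD !mulgA.
  + by rewrite !bruck_reilly_mulF // suffix_catr_id.
- move=> ->; rewrite !E.
  have [h1 h2] := noverlap_cat w ab ba.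
  by rewrite (bruck_reilly_mulF _ _ _ _ ab ba) bruck_reilly_mulF.
- by move=> -> ->; rewrite !E mulgA.
- by move=> -> ->; rewrite !E !catA !E size_cat iterD !mulgA.
- by move=> ->; rewrite !E !(bruck_reilly_mulF _ _ _ _ ab ba).
- by move=> ->; rewrite !E !(bruck_reilly_mulF _ _ _ _ bc cb).
- move=> ->; rewrite !E (bruck_reilly_mulF _ _ _ _ bc cb).
  have [h1 h2] := noverlap_cat v cb bc.
  by rewrite bruck_reilly_mulF.
- by rewrite !(bruck_reilly_mulF _ _ _ _ bc cb) (bruck_reilly_mulF _ _ _ _ ab ba).
Qed.

HB.instance Definition _ :=
  isSemigroup.Build (bruck_reilly lambda theta) bruck_reilly_mulA.

Lemma bruck_reilly_is_zero : is_zero (None : bruck_reilly lambda theta).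
Proof. by move=> x; split=> //; exact: bruck_reilly_mulx0. Qed.

End BruckReilly.

Section Polycyclic.
Variable lambda : choiceType.
Implicit Types (i j : lambda) (a b u v : seq lambda).
Local Notation mul := (@polycyclic_mul lambda).

Lemma polycyclic_mulL a1 a2 u b2 :
  mul (Some (a1, a2)) (Some (u ++ a2, b2)) = Some (u ++ a1, b2).
Proof. by rewrite /polycyclic_mul suffix_suffix strip_cat. Qed.

Lemma polycyclic_mulR a1 v b1 b2 :
  mul (Some (a1, v ++ b1)) (Some (b1, b2)) = Some (a1, v ++ b2).
Proof.
rewrite /polycyclic_mul suffix_suffix strip_cat.
by case: ifP => // /suffix_cat_nil ->; rewrite /strip subnn take0.
Qed.

Lemma polycyclic_mulF a1 a2 b1 b2 :
  suffix a2 b1 = false -> suffix b1 a2 = false ->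
  mul (Some (a1, a2)) (Some (b1, b2)) = None.
Proof. by rewrite /polycyclic_mul => -> ->. Qed.

Lemma polycyclic_mulx0 x : mul x None = None.
Proof. by case: x => [[]|]. Qed.

Lemma polycyclic_mulA : associative mul.
Proof.
have E := (polycyclic_mulL, polycyclic_mulR).
move=> [[a1 a2]|//] [[b1 b2]|//].
move=> [[c1 c2]|]; last by rewrite !polycyclic_mulx0.
have [w|w|bc cb] := overlapP b2 c1; have [u|v|ab ba] := overlapP a2 b1.
- by move=> -> ->; rewrite !E !catA !E.
- move=> -> ->; rewrite !E.
  have [k ->|k ->|vw wv] := overlapP v w.
  + by rewrite -!catA !E.
  + by rewrite -!catA !E.
  + by rewrite !polycyclic_mulF // suffix_catr_id.
- move=> ->; rewrite !E.
  have [h1 h2] := noverlap_cat w ab ba.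
  by rewrite (polycyclic_mulF _ _ ab ba) polycyclic_mulF.
- by move=> -> ->; rewrite !E.
- by move=> -> ->; rewrite !E !catA !E.
- by move=> ->; rewrite !E !(polycyclic_mulF _ _ ab ba).
- by move=> ->; rewrite !E !(polycyclic_mulF _ _ bc cb).
- move=> ->; rewrite !E (polycyclic_mulF _ _ bc cb).
  have [h1 h2] := noverlap_cat v cb bc.
  by rewrite polycyclic_mulF.
- by rewrite !(polycyclic_mulF _ _ bc cb) (polycyclic_mulF _ _ ab ba).
Qed.

Lemma polycyclic_mul1x : left_id (Some ([::], [::])) mul.
Proof.
by case=> [[a b]|//]; have := polycyclic_mulL [::] [::] a b; rewrite !cats0.
Qed.

Lemma polycyclic_mulx1 : right_id (Some ([::], [::])) mul.
Proof.
by case=> [[a b]|//]; have := polycyclic_mulR a b [::] [::]; rewrite !cats0.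
Qed.

HB.instance Definition _ := isMonoid.Build (polycyclic lambda)
  polycyclic_mulA polycyclic_mul1x polycyclic_mulx1.

Definition polycyclic_p i : polycyclic lambda := Some ([::], [:: i]).
Definition polycyclic_pV i : polycyclic lambda := Some ([:: i], [::]).

Lemma polycyclic_is_zero : is_zero (None : polycyclic lambda).
Proof. by move=> x; split=> //; exact: polycyclic_mulx0. Qed.

Lemma polycyclic_rel i : polycyclic_p i * polycyclic_pV i = 1.
Proof. exact: (polycyclic_mulL [::] [:: i] [::] [::]). Qed.

Lemma polycyclic_rel0 i j : i <> j -> polycyclic_p i * polycyclic_pV j = None.
Proof.
move=> ij; apply: polycyclic_mulF; apply/negbTE/negP.
  by rewrite /suffix /= eq_sym andbT => /eqP ji; apply: ij.
by rewrite /suffix /= eq_sym andbT => /eqP ji; apply: ij.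
Qed.

Section Universal.
Variables (M : monoidType) (z : M) (p q : lambda -> M).
Hypotheses (zP : is_zero z) (pq : forall i, p i * q i = 1).
Hypothesis pq0 : forall i j, i <> j -> p i * q j = z.

Let P a := \prod_(i <- a) p i.
Let Q a := \prod_(i <- rev a) q i.

Let Pcat a b : P (a ++ b) = P a * P b. Proof. exact: big_cat. Qed.
Let Qcat a b : Q (a ++ b) = Q b * Q a.
Proof. by rewrite /Q rev_cat big_cat. Qed.

Let PQ a : P a * Q a = 1.
Proof.
elim/last_ind: a => [|a i IH]; first by rewrite /P /Q !big_nil mulg1.
rewrite -cats1 Pcat Qcat [P [:: i]]big_seq1 [Q [:: i]]big_seq1.
by rewrite mulgA -[_ * p i * _]mulgA pq mulg1.
Qed.

Let PQ0 a b : suffix a b = false -> suffix b a = false -> P a * Q b = z.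
Proof.
elim/last_ind: a b => [|a i IH] b; first by rewrite suffix0s.
elim/last_ind: b => [|b j _]; first by rewrite suffix0s.
rewrite !suffix_rcons -!cats1 Pcat Qcat.
rewrite [P [:: i]]big_seq1 [Q [:: j]]big_seq1 mulgA -[_ * p i * _]mulgA.
have [->|/eqP ij _ _] := eqVneq i j; first by rewrite pq mulg1 /=; exact: IH.
by rewrite (pq0 ij) (zP _).2 (zP _).1.
Qed.

Lemma polycyclic_universal :
  exists! f : polycyclic lambda -> M,
    [/\ {morph f : x y / x * y}, f 1 = 1, f None = z,
        forall i, f (polycyclic_p i) = p i
      & forall i, f (polycyclic_pV i) = q i].
Proof.
pose f (x : polycyclic lambda) := if x is Some (a, b) then Q a * P b else z.
exists f; split.
  split=> //.
  - move=> [[a1 a2]|]; last by move=> y /=; rewrite (zP _).1.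
    move=> [[b1 b2]|]; last by rewrite (polycyclic_is_zero _).2 /= (zP _).2.
    rewrite /=.
    have -> : Q a1 * P a2 * (Q b1 * P b2) = Q a1 * (P a2 * Q b1) * P b2.
      by rewrite !mulgA.
    have [u ->|v ->|ab ba] := overlapP a2 b1.
    + rewrite [_ * _ in LHS]polycyclic_mulL /= !Qcat !mulgA.
      by rewrite -[_ * P a2 * _]mulgA PQ mulg1.
    + rewrite [_ * _ in LHS]polycyclic_mulR /= !Pcat -!mulgA.
      by rewrite [P b1 * _]mulgA PQ mul1g.
    + by rewrite [_ * _ in LHS]polycyclic_mulF //= PQ0 // (zP _).2 (zP _).1.
  - by rewrite /= /P /Q !big_nil mulg1.
  - by move=> i; rewrite /= /P /Q big_nil big_seq1 mul1g.
  - by move=> i; rewrite /= /P /Q big_nil big_seq1 mulg1.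
move=> g [gM g1 g0 gp gq]; apply: boolp.funext => -[[a b]|]; last by rewrite g0.
change (Q a * P b = g (Some (a, b))).
have -> : Some (a, b) = (Some (a, [::]) : polycyclic lambda) * Some ([::], b).
  exact/esym/(polycyclic_mulR a [::] [::] b).
rewrite gM; congr (_ * _).
  elim/last_ind: a => [|a i IH]; first by rewrite g1 /Q big_nil.
  rewrite -cats1 Qcat [Q [:: i]]big_seq1 IH -gq -gM; congr (g _).
  by have /esym := polycyclic_mulL [:: i] [::] a [::]; rewrite cats0.
elim/last_ind: b => [|b i IH]; first by rewrite g1 /P big_nil.
rewrite -cats1 Pcat [P [:: i]]big_seq1 IH -gp -gM; congr (g _).
by have /esym := polycyclic_mulR [::] b [::] [:: i]; rewrite cats0.
Qed.
End Universal.
End Polycyclic.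

(* Main.v *)
Require Import Defs.
From mathcomp Require Import all_boot.
From mathcomp Require Import classical_sets.

(** Both Green relations on the extension are computed coordinatewise:
    (s, a^-1 b) L (t, c^-1 d) iff b = d and s L t in S, and dually
    (s, a^-1 b) R (t, c^-1 d) iff a = c and s R t in S.  Indeed multiplying on
    the left can only lengthen the word b, and when it leaves b unchanged it
    multiplies s on the left by an element of S.  Composing the two,
    any two nonzero elements are D-related iff their S-components are, while
    the zero is D-related only to itself. *)

Local Open Scope classical_set_scope.

(** * Green's relations in an arbitrary semigroup, possibly with zero *)

Section GreenTheory.
Set Implicit Arguments.
Unset Strict Implicit.
Local Open Scope group_scope.
Variable T : semigroupType.
Implicit Types x y z : T.

Lemma lideal_sub x y : lideal x y -> lideal y `<=` lideal x.
Proof.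
move=> [->//|[t _ <-]] w [->|[r _ <-]]; right; first by exists t.
by exists (r * t) => //; rewrite mulgA.
Qed.

Lemma rideal_sub x y : rideal x y -> rideal y `<=` rideal x.
Proof.
move=> [->//|[t _ <-]] w [->|[r _ <-]]; right; first by exists t.
by exists (t * r) => //; rewrite mulgA.
Qed.

Lemma greenLP x y : greenL x y <-> lideal x y /\ lideal y x.
Proof.
split=> [xy|[xy yx]]; last by apply/seteqP; split; exact: lideal_sub.
by split; [rewrite xy|rewrite -xy]; left.
Qed.

Lemma greenRP x y : greenR x y <-> rideal x y /\ rideal y x.
Proof.
split=> [xy|[xy yx]]; last by apply/seteqP; split; exact: rideal_sub.
by split; [rewrite xy|rewrite -xy]; left.
Qed.

Lemma greenD_refl x : greenD x x.
Proof. by exists x. Qed.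

Lemma greenL_zero z x : is_zero z -> greenL z x -> x = z.
Proof. by move=> z0 /greenLP[[//|[t _ <-]] _]; exact: (z0 t).2. Qed.

Lemma greenR_zero z x : is_zero z -> greenR z x -> x = z.
Proof. by move=> z0 /greenRP[[//|[t _ <-]] _]; exact: (z0 t).1. Qed.

Lemma greenD_zerol z x : is_zero z -> greenD z x -> x = z.
Proof. by move=> z0 [w /(greenL_zero z0)->]; exact: greenR_zero. Qed.

Lemma greenD_zeror z x : is_zero z -> greenD x z -> x = z.
Proof.
move=> z0 [w xw /esym/(greenR_zero z0) wz].
by move: xw; rewrite wz => /esym/(greenL_zero z0).
Qed.

Lemma is_zero_uniq z z' : is_zero z -> is_zero z' -> z = z'.
Proof. by move=> z0 z'0; rewrite -(z0 z').1 (z'0 z).2. Qed.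

(** The point [x0] excludes the empty semigroup, which satisfies the right-hand side vacuously but
    has no D-class. *)
Lemma bisimpleP x0 : bisimple T <-> forall x y, greenD x y.
Proof.
split=> [[C DC] x y|D].
  have mem w : [set v | greenD w v] = C.
    suff : D_classes [set v | greenD w v] by rewrite DC.
    by exists w.
  suff : [set v | greenD x v] y by [].
  by rewrite mem -(mem y); exact: greenD_refl.
have DT x : [set y | greenD x y] = setT by apply/seteqP; split=> // y _; exact: D.
exists setT; apply/seteqP.
by split=> [_ [x _ <-]|_ ->]; [exact: DT|exists x0].
Qed.

(** A zero is D-related only to itself, so [[set z]] is always a class. What remains is that the
    complement of [z] is a single class, and a class is nonempty. *)
Lemma zero_bisimpleP z : is_zero z ->
  zero_bisimple T <->
  (exists x, x <> z) /\ forall x y, x <> z -> y <> z -> greenD x y.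
Proof.
move=> z0; split=> [[z' /(is_zero_uniq z0) <- DC]|[[x xz] D]].
  split.
    have : D_classes (~` [set z]) by rewrite DC; right.
    move=> [x _ Dx]; exists x; suff : (~` [set z]) x by [].
    by rewrite -Dx; exact: greenD_refl.
  move=> x y xz yz.
  have : D_classes [set v | greenD x v] by exists x.
  rewrite DC => -[] Dx; last first.
    by suff : [set v | greenD x v] y by []; rewrite Dx.
  by have : [set v | greenD x v] x; [exact: greenD_refl|rewrite Dx].
exists z => //.
have Dz : [set y | greenD z y] = [set z].
  apply/seteqP; split=> [y|_ ->]; [exact: greenD_zerol|exact: greenD_refl].
have Dnz w : w <> z -> [set y | greenD w y] = ~` [set z].
  move=> wz; apply/seteqP; split=> [y wy yz|y]; last exact: D.
  by apply: wz; apply: greenD_zeror => //; rewrite -[X in greenD _ X]yz.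
apply/seteqP; split=> [_ [w _ <-]|_ [->|->]].
- by have [->|wz] := boolp.EM (w = z); [left|right; exact: Dnz].
- by exists z.
- by exists x => //; exact: Dnz.
Qed.

End GreenTheory.

(** * Green's relations in the Bruck-Reilly extension *)

Section BruckReillyGreen.
Set Implicit Arguments.
Unset Strict Implicit.
Local Open Scope group_scope.
Variables (lambda : choiceType) (S : monoidType).
Variable theta : {multiplicative S -> S}.
Local Notation BR := (bruck_reilly lambda theta).
Implicit Types (s t : S) (a b c d : seq lambda).

Definition br_pair s a b : BR := Some (s, (a, b)).

Lemma br_mulL s t a1 a2 u b2 :
  br_pair s a1 a2 * br_pair t (u ++ a2) b2 =
  br_pair (iter (size u) theta s * t) (u ++ a1) b2.
Proof. exact: bruck_reilly_mulL. Qed.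

Lemma br_mulR s t a1 v b1 b2 :
  br_pair s a1 (v ++ b1) * br_pair t b1 b2 =
  br_pair (s * iter (size v) theta t) a1 (v ++ b2).
Proof. exact: bruck_reilly_mulR. Qed.

Lemma br_mul0 s t a1 a2 b1 b2 : suffix a2 b1 = false -> suffix b1 a2 = false ->
  br_pair s a1 a2 * br_pair t b1 b2 = None.
Proof. exact: bruck_reilly_mulF. Qed.

(** A left factor whose second word is a suffix of [a] leaves [b] alone and multiplies [s] on the
    left. If that word is [v ++ a], then [b] becomes [v ++ b] and [s] is first replaced by its image
    under the [size v]-th iterate of [theta], so the S-components are compared only for empty
    [v]. *)
Lemma lideal_br s t a b c d : lideal (br_pair s a b) (br_pair t c d) ->
  exists2 w, d = w ++ b & w = [::] -> lideal s t.
Proof.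
move=> [[-> _ ->]|[[[r [e f]]|] _ //]].
  by exists [::] => // _; left.
rewrite -/(br_pair r e f); have [u ->|v ->|fa af] := overlapP f a.
- rewrite br_mulL => -[<- _ <-]; exists [::] => // _.
  by right; exists (iter (size u) theta r).
- rewrite br_mulR => -[<- _ <-]; exists v => // ->.
  by right; exists r.
- by rewrite br_mul0.
Qed.

Lemma rideal_br s t a b c d : rideal (br_pair s a b) (br_pair t c d) ->
  exists2 w, c = w ++ a & w = [::] -> rideal s t.
Proof.
move=> [[-> -> _]|[[[r [e f]]|] _]]; last by rewrite (bruck_reilly_is_zero _).2.
  by exists [::] => // _; left.
rewrite -/(br_pair r e f); have [u ->|v ->|be eb] := overlapP b e.
- rewrite br_mulL => -[<- <- _]; exists u => // ->.
  by right; exists r.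
- rewrite br_mulR => -[<- <- _]; exists [::] => // _.
  by right; exists (iter (size v) theta r).
- by rewrite br_mul0.
Qed.

Lemma br_lideal s t a c b : lideal s t -> lideal (br_pair s a b) (br_pair t c b).
Proof.
move=> st; right.
(* The case [t = s] needs a multiplier too, since [a] and [c] may differ; the identity of [S]
   provides it. *)
have [r <-] : exists r, r * s = t.
  by case: st => [->|[r _ <-]]; [exists 1; rewrite mul1g|exists r].
by exists (br_pair r c a) => //; exact: (br_mulL r s c a [::] b).
Qed.

Lemma br_rideal s t a b d : rideal s t -> rideal (br_pair s a b) (br_pair t a d).
Proof.
move=> st; right.
have [r <-] : exists r, s * r = t.
  by case: st => [->|[r _ <-]]; [exists 1; rewrite mulg1|exists r].
by exists (br_pair r b d) => //; exact: (br_mulL s r a b [::] d).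
Qed.

(** Mutual divisibility makes two words suffixes of each other; the added prefixes are then empty,
    which unlocks the conditional halves of [lideal_br] and [rideal_br]. *)
Lemma cat_antisym a b u v : a = u ++ b -> b = v ++ a -> u = [::] /\ v = [::].
Proof.
move=> ab ba; have v0 : v = [::].
  by apply: (@suffix_cat_nil _ v a); rewrite -ba ab suffix_suffix.
by split=> //; apply: (@suffix_cat_nil _ u b); rewrite -ab ba v0 suffix_refl.
Qed.

Lemma greenL_br s t a b c d :
  greenL (br_pair s a b) (br_pair t c d) <-> b = d /\ greenL s t.
Proof.
split=> [/greenLP[/lideal_br[u du st] /lideal_br[v bv ts]]|[<- /greenLP[st ts]]].
  have [u0 v0] := cat_antisym du bv.
  by split; [rewrite du u0|apply/greenLP; split; [exact: st|exact: ts]].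
by apply/greenLP; split; exact: br_lideal.
Qed.

Lemma greenR_br s t a b c d :
  greenR (br_pair s a b) (br_pair t c d) <-> a = c /\ greenR s t.
Proof.
split=> [/greenRP[/rideal_br[u cu st] /rideal_br[v av ts]]|[<- /greenRP[st ts]]].
  have [u0 v0] := cat_antisym cu av.
  by split; [rewrite cu u0|apply/greenRP; split; [exact: st|exact: ts]].
by apply/greenRP; split; exact: br_rideal.
Qed.

Lemma greenD_br s t a b c d :
  greenD (br_pair s a b) (br_pair t c d) <-> greenD s t.
Proof.
split=> [[[[r [e f]]|] sr rt]|[r sr rt]].
- exists r; first exact: ((greenL_br s r a b e f).1 sr).2.
  exact: ((greenR_br r t e f c d).1 rt).2.
(* The intermediate element cannot be the zero, which is R-related to no pair. *)
- by have := greenR_zero (@bruck_reilly_is_zero lambda S theta) rt.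
(* The L-relation forces the second word [b] of the left element, the R-relation the first word [c]
   of the right one. *)
- by exists (br_pair r c b); [apply/greenL_br|apply/greenR_br].
Qed.

End BruckReillyGreen.

Theorem mainTheorem8 (lambda : choiceType) (lambda_neq0 : inhabited lambda)
  (S : monoidType) (theta : {multiplicative S -> S})
  (theta_units : range theta `<=` group_of_units S) :
  zero_bisimple (bruck_reilly lambda theta) <-> bisimple S.
Proof.
rewrite (zero_bisimpleP (@bruck_reilly_is_zero lambda S theta)) (bisimpleP (1%g : S)).
split=> [[_ D] s t|D].
  (* Any words would serve here, since D does not see them. *)
  exact/(greenD_br theta s t [::] [::] [::] [::])/D.
split; first by exists (Some (1%g, ([::], [::]))).
by move=> [[s [a b]]|//] [[t [c d]]|//] _ _; apply/greenD_br.
Qed.
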